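(* Let $\beta$ be a soft c-base on $X$. Then the family $\zeta_{\beta}\subseteq\mathcal{S}_{E}(X)$ consisting of all $\Omega_{E}=(\Omega,E)\in\mathcal{S}_{E}(X)$ such that $(\Omega,E)=\widetilde{\bigcup}_{i \in I}(\Omega_{i}, E)$ for some soft upward directed family $\{(\Omega_{i},E): i\in I\}\subseteq\beta$ is a soft convex structure on $X$.
   Context: $X$ is a nonempty set and $E$ a nonempty set of parameters. A soft set on $X$ is a pair $\Omega_E=(\Omega,E)$ with $\Omega:E\to\mathcal{P}(X)$ a function; $\mathcal{S}_E(X)$ is the family of all soft sets on $X$. $\Omega_E\,\widetilde{\subseteq}\,O_E$ means $\Omega(e)\subseteq O(e)$ for all $e\in E$. Unions $\widetilde{\bigcup}$ and intersections $\widetilde{\bigcap}$ of families of soft sets are taken parameterwise: $e\mapsto\bigcup_i\Omega_i(e)$, respectively $e\mapsto\bigcap_i\Omega_i(e)$. $\Phi_E$ is the soft set with value $\emptyset$ at every $e\in E$, and $X_E$ the soft set with value $X$ at every $e\in E$. A family $\{(\Omega_i,E):i\in I\}$ of soft sets on $X$ is soft upward directed if for each pair $i_1,i_2\in I$ there is $i_3\in I$ with $\Omega_{i_1}\,\widetilde{\subseteq}\,\Omega_{i_3}$ and $\Omega_{i_2}\,\widetilde{\subseteq}\,\Omega_{i_3}$. The index set may be empty: the empty family counts as a soft upward directed family (contained in any $\beta$), and its union is $\Phi_E$. A family $\zeta\subseteq\mathcal{S}_E(X)$ is a soft convex structure on $X$ if: (i) $\Phi_E,X_E\in\zeta$; (ii)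 the intersection of each family of members of $\zeta$ belongs to $\zeta$; (iii) the union of each soft upward directed family of members of $\zeta$ belongs to $\zeta$. A family $\beta\subseteq\mathcal{S}_E(X)$ is a soft c-base (soft convex base) on $X$ if: (SCB1) $X_E=\widetilde{\bigcup}_{i\in I}(\Omega_i,E)$ for some soft upward directed family $\{(\Omega_i,E):i\in I\}\subseteq\beta$; (SCB2) for each family $\{(\Omega_i,E):i\in I\}\subseteq\beta$ there exists a soft upward directed family $\{(O_j,E):j\in J\}\subseteq\beta$ such that $\widetilde{\bigcap}_{i\in I}(\Omega_i,E)=\widetilde{\bigcup}_{j\in J}(O_j,E)$; (SCB3) if $\{(\Omega_i,E):i\in I\}\subseteq\mathcal{S}_E(X)$ is a soft upward directed family and, for every $i\in I$, $\{(O_{ij},E):j\in J_i\}\subseteq\beta$ is a soft upward directed family with $(\Omega_i,E)=\widetilde{\bigcup}_{j\in J_i}(O_{ij},E)$, then there exists a soft upward directed family $\{(O_k,E):k\in K\}\subseteq\beta$ such that $\widetilde{\bigcup}_{i\in I}(\Omega_i,E)=\widetilde{\bigcup}_{k\in K}(O_k,E)$. *)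

(* Defs.v *)
From mathcomp Require Import all_boot.
From mathcomp Require Import boolp classical_sets.
Set Implicit Arguments.
Unset Strict Implicit.
Unset Printing Implicit Defensive.
Local Open Scope classical_set_scope.

(* The parameter set E is fixed throughout, so the soft set (Omega, E) is
   represented by the function Omega alone. *)
Definition softset (E X : Type) : Type := E -> set X.

Section SoftSets.
Variables E X : Type.

Definition soft_sub (O1 O2 : softset E X) : Prop :=
  forall e, O1 e `<=` O2 e.

Definition soft_null : softset E X := fun=> set0.

Definition soft_abs : softset E X := fun=> [set: X].

(* Over an empty index type the union is [soft_null] and the intersection is
   [soft_abs]. *)
Definition soft_bigcup (I : Type) (F : I -> softset E X) : softset E X :=
  fun e => \bigcup_i F i e.

Definition soft_bigcap (I : Type) (F : I -> softset E X) : softset E X :=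
  fun e => \bigcap_i F i e.

(* The index type may be empty. *)
Definition soft_updirected (I : Type) (F : I -> softset E X) : Prop :=
  forall i1 i2, exists i3, soft_sub (F i1) (F i3) /\ soft_sub (F i2) (F i3).

Definition family_in (A : set (softset E X)) (I : Type)
    (F : I -> softset E X) : Prop :=
  forall i, A (F i).

Record soft_convex_structure (zeta : set (softset E X)) : Prop := {
  scs_null : zeta soft_null;
  scs_abs : zeta soft_abs;
  scs_bigcap : forall (I : Type) (F : I -> softset E X),
    family_in zeta F -> zeta (soft_bigcap F);
  scs_bigcup : forall (I : Type) (F : I -> softset E X),
    family_in zeta F -> soft_updirected F -> zeta (soft_bigcup F)
}.

Definition updirected_union_of (beta : set (softset E X))
    (O : softset E X) : Prop :=
  exists (I : Type) (F : I -> softset E X),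
    [/\ family_in beta F, soft_updirected F & O = soft_bigcup F].

Record soft_c_base (beta : set (softset E X)) : Prop := {
  scb1 : updirected_union_of beta soft_abs;
  scb2 : forall (I : Type) (F : I -> softset E X),
    family_in beta F -> updirected_union_of beta (soft_bigcap F);
  scb3 : forall (I : Type) (F : I -> softset E X)
      (J : I -> Type) (O : forall i, J i -> softset E X),
    soft_updirected F ->
    (forall i, [/\ family_in beta (O i), soft_updirected (O i)
                 & F i = soft_bigcup (O i)]) ->
    updirected_union_of beta (soft_bigcup F)
}.

Definition generated_family (beta : set (softset E X)) : set (softset E X) :=
  [set O | updirected_union_of beta O].

End SoftSets.

Arguments soft_null {E X}.
Arguments soft_abs {E X}.

(* Main.v *)
Require Import Defs.
From mathcomp Require Import all_boot.
From mathcomp Require Import boolp classical_sets.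
Local Open Scope classical_set_scope.

(** Closure under directed unions is what (SCB3) provides, once a directed
    representation by members of [beta] has been chosen for every member of the
    family; the top soft set is (SCB1), and the null soft set is the union of
    the empty family.

    The substance is closure under intersections.  If [F i] is the directed
    union of the [O i j], [j : J i], complete distributivity of the power set
    rewrites the intersection of the [F i] as the union, over all choice
    functions [f] with [f i : J i], of the soft sets
    [G f = soft_bigcap (fun i => O i (f i))].  The [G f] form a directed
    family, because upper bounds can be chosen coordinatewise, and by (SCB2)
    each [G f] is itself a directed union of members of [beta].  The already
    established closure under directed unions, applied to [G], concludes. *)

Section GeneratedFamily.
Context {E X : Type}.
Implicit Types beta : set (softset E X).

(** (SCB3) takes the representations of the members as a given family, whereas
    membership in the generated family only asserts their existence: this is
    the choice principle that links the two. *)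
Lemma choose_updirected_unions {beta} {I : Type} {F : I -> softset E X} :
  family_in (generated_family beta) F ->
  exists (J : I -> Type) (O : forall i, J i -> softset E X),
    forall i, [/\ family_in beta (O i), soft_updirected (O i)
                & F i = soft_bigcup (O i)].
Proof.
move=> Fgen; pose J i := projT1 (cid (Fgen i)).
pose O i : J i -> softset E X := projT1 (cid (projT2 (cid (Fgen i)))).
by exists J, O => i; exact: projT2 (cid (projT2 (cid (Fgen i)))).
Qed.

Lemma generated_bigcup {beta} {I : Type} {F : I -> softset E X} :
  soft_c_base beta -> family_in (generated_family beta) F ->
  soft_updirected F -> generated_family beta (soft_bigcup F).
Proof.
move=> hbeta /choose_updirected_unions[J [O FO]] Fdir.
exact: (scb3 hbeta Fdir FO).
Qed.

Section ChoiceFunctions.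
Context {I : Type} {J : I -> Type} (O : forall i, J i -> softset E X).

Lemma soft_bigcap_bigcup_distr :
  soft_bigcap (fun i => soft_bigcup (O i)) =
  soft_bigcup (fun f : forall i, J i => soft_bigcap (fun i => O i (f i))).
Proof.
apply/funext => e; apply/seteqP; split => x.
- move=> xO; have {}xO i : exists j, O i j e x.
    by have [j _ Oj] := xO i Logic.I; exists j.
  by exists (fun i => projT1 (cid (xO i))) => // i _; exact: projT2 (cid (xO i)).
- by move=> [f _ xO] i _; exists (f i) => //; exact: xO.
Qed.

Lemma updirected_bigcap_choice :
  (forall i, soft_updirected (O i)) ->
  soft_updirected (fun f : forall i, J i => soft_bigcap (fun i => O i (f i))).
Proof.
move=> Odir f g; pose ub i := cid (Odir i (f i) (g i)).
exists (fun i => projT1 (ub i)); split=> e x xO i _;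
  have [fub gub] := projT2 (ub i).
- by apply: fub; exact: xO.
- by apply: gub; exact: xO.
Qed.

End ChoiceFunctions.

Lemma generated_bigcap {beta} {I : Type} {F : I -> softset E X} :
  soft_c_base beta -> family_in (generated_family beta) F ->
  generated_family beta (soft_bigcap F).
Proof.
move=> hbeta /choose_updirected_unions[J [O FO]].
have -> : F = fun i => soft_bigcup (O i) by apply/funext => i; case: (FO i).
rewrite soft_bigcap_bigcup_distr; apply: (generated_bigcup hbeta).
- by move=> f; apply: (scb2 hbeta) => i; case: (FO i) => Obeta _ _; exact: Obeta.
- by apply: updirected_bigcap_choice => i; case: (FO i).
Qed.

Lemma generated_null beta : generated_family beta soft_null.
Proof.
exists False, (fun=> soft_null); split; [by case | by case |].
by apply/funext => e; apply/seteqP; split=> x // [[]].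
Qed.

End GeneratedFamily.

Theorem theorem5p1 (E X : Type) (hE : [set: E] !=set0) (hX : [set: X] !=set0)
  (beta : set (softset E X)) (hbeta : soft_c_base beta) :
  soft_convex_structure (generated_family beta).
Proof.
split.
- exact: generated_null.
- exact: scb1 hbeta.
- by move=> I F; exact: generated_bigcap.
- by move=> I F; exact: generated_bigcup.
Qed.
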